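(* (a) For every finite loopless directed graph $G$ with $k:=\psi_d^*(G)>1$ we have $$\chi^*(G)\le\frac{k^k}{(k-1)^{k-1}}<ek,$$ where $e$ is the base of the natural logarithm. (b) For every real $k\ge 2$ and every $\varepsilon>0$ there exists a finite loopless directed graph $G$ with $\psi_d^*(G)\le k$ and $$\chi^*(G)>\frac{k^k}{(k-1)^{k-1}}-\varepsilon.$$ If $k$ is an integer, then such a $G$ can be chosen to further satisfy $\psi_d(G)=k$.
   Context: For a directed graph $G$, $S(G)$ denotes the set of independent sets of its underlying undirected graph, and a proper coloring of $G$ is a proper coloring of the underlying undirected graph. A fractional coloring of $G$ is a family $(x_A)_{A\in S(G)}$ of nonnegative reals with $\sum_{A\ni v}x_A\ge 1$ for every vertex $v$; $\chi^*(G)$ (the fractional chromatic number of the underlying undirected graph) is the minimum of $\sum_A x_A$ over fractional colorings. The local weight of a fractional coloring is $1+\max_{v}\sum_{A\in S(G):\,N_+(v)\cap A\ne\emptyset}x_A$, where $N_+(v)$ is the set of out-neighbors of $v$, and $\psi_d^*(G)$ is the minimum local weight of a fractional coloring. The directed local chromatic number is $\psi_d(G):=\min_c\max_{v}|\{c(u):u\in N_+(v)\}|+1$ over proper colorings $c$ of $G$. *)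

(* Defs.v *)
From HB Require Import structures.
From mathcomp Require Import all_boot all_order all_algebra.
From mathcomp Require Import all_classical all_reals all_analysis.

Set Implicit Arguments.
Unset Strict Implicit.
Unset Printing Implicit Defensive.

Import Order.TTheory GRing.Theory Num.Theory.
Import numFieldNormedType.Exports.

Local Open Scope classical_set_scope.
Local Open Scope ring_scope.

(* Antiparallel arcs u -> v and v -> u are allowed. *)
Record digraph := Digraph {
  vertex :> finType;
  arc : rel vertex;
  arc_irrefl : irreflexive arc
}.

Section Digraph.
Variable G : digraph.

Definition adj : rel G := fun u v => arc u v || arc v u.

Definition out_neighbors (v : G) : {set G} := [set u | arc v u]%SET.

Definition indep_sets : {set {set G}} :=
  [set A : {set G} | [forall u in A, forall v in A, ~~ adj u v]]%SET.

Definition proper_coloring (c : G -> nat) : Prop :=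
  forall u v : G, adj u v -> c u != c v.

(* [undup] makes the size count distinct colors. *)
Definition num_out_colors (c : G -> nat) (v : G) : nat :=
  size (undup [seq c u | u in out_neighbors v]).

Definition max_out_colors (c : G -> nat) : nat :=
  (\max_(v : G) num_out_colors c v)%N.

Definition local_color_count : pred nat := fun m =>
  `[< exists2 c, proper_coloring c & m = (max_out_colors c).+1 >].

Lemma local_color_count_nonempty : exists m, local_color_count m.
Proof.
pose c (v : G) : nat := enum_rank v.
exists (max_out_colors c).+1; apply/asboolP; exists c => // u v uv.
apply/negP => /eqP /val_inj /enum_rank_inj euv.
by move: uv; rewrite /adj euv !arc_irrefl.
Qed.

Definition dir_local_chromatic : nat := ex_minn local_color_count_nonempty.

Variable R : realType.

(* A family (x_A) indexed by the independent sets is represented by a function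
   on all vertex sets; its values off [indep_sets] are never used. *)
Definition fractional_coloring : set ({set G} -> R) :=
  [set x | (forall A, A \in indep_sets -> 0 <= x A) /\
           (forall v : G, 1 <= \sum_(A in indep_sets | v \in A) x A)].

Definition total_weight (x : {set G} -> R) : R := \sum_(A in indep_sets) x A.

Definition out_weight (x : {set G} -> R) (v : G) : R :=
  \sum_(A in indep_sets | (out_neighbors v :&: A)%SET != finset.set0) x A.

(* The default value 0 of the maximum only matters when [G] has no vertex, as
   [out_weight x v] is nonnegative for a fractional coloring [x]. *)
Definition local_weight (x : {set G} -> R) : R :=
  1 + \big[Num.max/0]_(v : G) out_weight x v.

(* The two infima below are minima: see [frac_chromatic_attained] and
   [dir_local_frac_chromatic_attained]. *)
Definition frac_chromatic : R :=
  inf [set total_weight x | x in fractional_coloring].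

Definition dir_local_frac_chromatic : R :=
  inf [set local_weight x | x in fractional_coloring].

Section Attained.
Import ArrowAsProduct.

Let coord_cont (A : {set G}) : continuous (fun x : {set G} -> R => x A).
Proof. exact: (@proj_continuous {set G} (fun=> R) A). Qed.

Let sum_cont (P : pred {set G}) :
  continuous (fun x : {set G} -> R => \sum_(A | P A) x A).
Proof.
by apply: continuous_big => [|A _]; [exact: add_continuous|exact: coord_cont].
Qed.

Let trunc (x : {set G} -> R) : {set G} -> R :=
  fun A => if A \in indep_sets then Num.min (x A) 1 else 0.

Let box : set ({set G} -> R) := [set x | forall A, `[0, 1]%classic (x A)].

Let singleton_indep v : [set v]%SET \in indep_sets.
Proof.
rewrite inE; apply/forall_inP => u /set1P->; apply/forall_inP => w /set1P->.
by rewrite /adj arc_irrefl.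
Qed.

Let fractional_coloring1 : fractional_coloring (fun=> 1).
Proof.
split=> [A _|v]; first exact: ler01.
rewrite (bigD1 [set v]%SET) /=; last by rewrite singleton_indep inE eqxx.
by rewrite lerDl sumr_ge0.
Qed.

Let trunc_frac x : fractional_coloring x -> fractional_coloring (trunc x).
Proof.
move=> [x0 x1]; split=> [A AI|v]; first by rewrite /trunc AI le_min x0 /= ?ler01.
have t0 A : A \in indep_sets -> 0 <= trunc x A.
  by move=> AI; rewrite /trunc AI le_min x0 /= ?ler01.
have [/existsP[A /and3P[AI vA xA]]|] :=
  boolP [exists A, [&& A \in indep_sets, v \in A & 1 <= x A]].
  rewrite (bigD1 A) /= ?AI //; rewrite -[leLHS]addr0 lerD //.
    by rewrite /trunc AI min_r.
  by apply: sumr_ge0 => B /andP[/andP[BI _] _]; exact: t0.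
rewrite negb_exists => /forallP xlt1; rewrite (le_trans (x1 v)) //.
apply: ler_sum => A /andP[AI vA]; rewrite /trunc AI min_l //.
by have := xlt1 A; rewrite AI vA /= -ltNge => /ltW.
Qed.

Let trunc_box x : fractional_coloring x -> box (trunc x).
Proof.
move=> [x0 _] A /=; rewrite in_itv /= /trunc; case: ifPn => AI.
  by rewrite le_min x0 //= ler01 ge_min lexx orbT.
by rewrite lexx ler01.
Qed.

Let attained (f : ({set G} -> R) -> R) : continuous f ->
  (forall x, fractional_coloring x -> f (trunc x) <= f x) ->
  exists2 x, fractional_coloring x & f x = inf [set f y | y in fractional_coloring].
Proof.
move=> fc ft.
have fracB : fractional_coloring =
  (\bigcap_(A in [set A | A \in indep_sets]) [set x | 0 <= x A]) `&`
  (\bigcap_(v in [set: G])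
     [set x : {set G} -> R | 1 <= \sum_(A in indep_sets | v \in A) x A]).
  apply/seteqP; split=> x /=.
    by move=> [x0 x1]; split=> [A AI|v _]; [exact: x0|exact: x1].
  by move=> [x0 x1]; split=> [A AI|v]; [exact: x0|exact: x1].
have cfrac : closed fractional_coloring.
  rewrite fracB; apply: closedI.
    apply: closed_bigI => A _.
    apply: (@preimage_closed _ _ (fun x : {set G} -> R => x A) [set r | 0 <= r]).
      by move=> x _; exact: coord_cont.
    exact: closed_ge.
  apply: closed_bigI => v _.
  apply: (@preimage_closed _ _ (fun x : {set G} -> R =>
    \sum_(A in indep_sets | v \in A) x A) [set r | 1 <= r]).
    by move=> x _; exact: sum_cont.
  exact: closed_ge.
have cK : compact (box `&` fractional_coloring).
  apply: compact_closedI => //.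
  by apply: (@tychonoff {set G} (fun=> R) (fun=> `[0, 1]%classic)) => A; exact: segment_compact.
have K0 : (box `&` fractional_coloring) !=set0.
  by exists (trunc (fun=> 1)); split; [exact: trunc_box|exact: trunc_frac].
have [|c /set_mem[_ cF] cmin] := @compact_EVT_min _ _ f _ K0 cK.
  exact: continuous_subspaceT.
have lbc y : fractional_coloring y -> f c <= f y.
  move=> yF; rewrite (le_trans _ (ft _ yF))// cmin// inE.
  by split; [exact: trunc_box|exact: trunc_frac].
exists c => //; apply/eqP; rewrite eq_le; apply/andP; split.
  by apply: lb_le_inf; [exists (f c), c|move=> _ [y yF <-]; exact: lbc].
by apply: ge_inf; [exists (f c) => _ [y yF <-]; exact: lbc|exists c].
Qed.

Let trunc_sum x (P : pred {set G}) :
  \sum_(A in indep_sets | P A) trunc x A <= \sum_(A in indep_sets | P A) x A.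
Proof.
by apply: ler_sum => A /andP[AI _]; rewrite /trunc AI ge_min lexx.
Qed.

Lemma frac_chromatic_attained :
  exists2 x, fractional_coloring x & total_weight x = frac_chromatic.
Proof.
apply: attained => [|x _]; first exact: sum_cont.
by apply: ler_sum => A AI; rewrite /trunc AI ge_min lexx.
Qed.

Lemma dir_local_frac_chromatic_attained :
  exists2 x, fractional_coloring x & local_weight x = dir_local_frac_chromatic.
Proof.
apply: attained => [x|x _].
  apply: (@continuousD R R^o); first exact: cst_continuous.
  elim: (index_enum G) => [|v s IH].
    rewrite [X in {for x, continuous X}](_ : _ = fun=> 0).
      exact: cst_continuous.
    by apply/funext => y; rewrite big_nil.
  rewrite [X in {for x, continuous X}](_ : _ = (fun y => out_weight y v) \max
      (fun y => \big[Num.max/0]_(u <- s) out_weight y u)).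
    by apply: continuous_max IH; exact: sum_cont.
  by apply/funext => y; rewrite big_cons.
rewrite lerD2l; elim/big_ind2: _ => // [a b a' b' ab ab'|v _].
  by rewrite ge_max !le_max ab ab' orbT.
exact: trunc_sum.
Qed.

End Attained.
End Digraph.

(* Main.v *)
Require Import Defs.
From mathcomp Require Import all_boot all_order all_algebra.
From mathcomp Require Import all_classical all_reals all_analysis.
From mathcomp Require Import ring lra.

Set Implicit Arguments.
Unset Strict Implicit.
Unset Printing Implicit Defensive.

Import Order.TTheory GRing.Theory Num.Theory.
Local Open Scope ring_scope.

(* Write f(k) = k^k / (k-1)^(k-1); then 1 / f(k) is the maximum of
   (1 - t) t^(k-1) over t in [0, 1], attained at t = (k-1)/k.

   (a) Given a fractional coloring x of local weight at most k, leave each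
   independent set A out of a random family with probability t^(x_A),
   independently. Keep a vertex if some member of the family contains it and
   no member meets its out-neighborhood. The kept vertices are independent and
   each vertex is kept with probability at least (1 - t) t^(k-1) = 1 / f(k),
   so that f(k) times the distribution of the set of kept vertices is a
   fractional coloring of total weight f(k).

   (b) For rational k = 1 + m/q with m >= q, take as vertices the pairs (a, b)
   of a q-tuple a of distinct elements of {1..n} and an m-tuple b avoiding the
   entries of a, with an arc from (a, b) to (a', b') when every entry of a' is
   an entry of b. Giving weight 1/q to the class of the vertices with i among
   the entries of a, for each i, shows that the local weight is at most k. In
   an independent set, no window of q cyclically consecutive entries of a b
   that occurs is equal to an a that occurs, so by Shearer's inequality the
   density of the b's is at most (1 - alpha)^(m/q), alpha being the density of
   the a's. Hence an independent set has at most
   n^(q+m) alpha (1 - alpha)^(k-1) <= n^(q+m) / f(k) vertices, while the graph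
   has n^(q+m) (1 - o(1)). An arbitrary real k is approximated from below by
   rationals; an integer k is handled with q = 1. *)

(** * The function k^k / (k-1)^(k-1) *)

Section ExtremalRatio.
Variable R : realType.
Implicit Types k t x : R.

Definition extremal_ratio k : R := (k `^ k) / ((k - 1) `^ (k - 1)).

Lemma extremal_ratio_gt0 k : 1 < k -> 0 < extremal_ratio k.
Proof. by move=> k1; rewrite divr_gt0 // powR_gt0; lra. Qed.

Lemma extremal_ratioE k : 1 < k ->
  extremal_ratio k = k * (k / (k - 1)) `^ (k - 1).
Proof.
move=> k1; rewrite powRM ?invr_ge0; [|lra..].
rewrite mulrA mulr_powRB1; [|lra..].
by rewrite -powR_inv1 1?powRAC ?powR_inv1 ?powR_ge0 //; lra.
Qed.

(** The left side regroups as (1 - t) k times the power k - 1 of t k / (k - 1). Bounding both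
    logarithms by ln y <= y - 1 gives the sum 0. *)
Lemma extremal_ratio_max k t : 1 < k -> 0 <= t -> t <= 1 ->
  (1 - t) * t `^ (k - 1) * extremal_ratio k <= 1.
Proof.
move=> k1 t0 t1; rewrite extremal_ratioE //.
rewrite [leLHS](_ : _ = ((1 - t) * k) * (t * (k / (k - 1))) `^ (k - 1)); last first.
  by rewrite [in RHS](@powRM _ t) // ?divr_ge0; [ring|lra..].
have [->|tn0] := eqVneq t 0.
  by rewrite mul0r powR0 ?mulr0 // ?ler01 // gt_eqF; lra.
have [->|tn1] := eqVneq t 1; first by rewrite subrr !mul0r ler01.
have k10 : 0 < k - 1 by lra.
have t00 : 0 < t by rewrite lt_def tn0.
have s00 : 0 < 1 - t by rewrite subr_gt0 lt_def eq_sym tn1.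
have kp : 0 < k by lra.
have c0 : 0 < t * (k / (k - 1)) by rewrite mulr_gt0 // divr_gt0.
have d0 : 0 < (1 - t) * k by rewrite mulr_gt0.
have lnB (y : R) : 0 < y -> ln y <= y - 1.
  by move=> y0; rewrite -[in ln y](addrNK 1 y) addrC le_ln1Dx //; lra.
rewrite -ler_ln ?posrE ?ltr01 ?mulr_gt0 ?powR_gt0 // lnM ?posrE ?powR_gt0 //.
rewrite ln1 ln_powR (le_trans (lerD (lnB _ d0) (ler_wpM2l (ltW k10) (lnB _ c0)))) //.
rewrite [leLHS](_ : _ = 0) //; field; lra.
Qed.

Lemma extremal_ratio_argmax k : 1 < k ->
  (1 - (k - 1) / k) * ((k - 1) / k) `^ (k - 1) * extremal_ratio k = 1.
Proof.
move=> k1; rewrite extremal_ratioE // mulrACA -powRM ?divr_ge0; [|lra..].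
have -> : (k - 1) / k * (k / (k - 1)) = 1 by field; lra.
by rewrite powR1 mulr1; field; lra.
Qed.

Lemma extremal_ratio_lt_expR k : 1 < k -> extremal_ratio k < expR 1 * k.
Proof.
move=> k1; rewrite extremal_ratioE // mulrC ltr_pM2r; last lra.
have k10 : 0 < k - 1 by lra.
rewrite -ltr_ln ?posrE ?expR_gt0 ?powR_gt0 ?divr_gt0 //; try lra.
rewrite expRK ln_powR -ltr_pdivlMl // mulr1.
have -> : k / (k - 1) = 1 + (k - 1)^-1 by field; lra.
rewrite -[ltRHS]expRK ltr_ln ?posrE ?expR_gt0 ?addr_gt0 ?invr_gt0 //.
by rewrite expR_gt1Dx // invr_eq0; lra.
Qed.

(* The maximizer [(k - 1) / k] for [k] is a competitor for the smaller
   exponent [k' - 1]. *)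
Lemma extremal_ratio_le_pow k k' : 1 < k' -> 1 < k ->
  extremal_ratio k' <= extremal_ratio k * ((k - 1) / k) `^ (k - k').
Proof.
move=> k'1 k1; set t := (k - 1) / k.
have t0 : 0 < t by rewrite divr_gt0; lra.
have t1 : t < 1 by rewrite ltr_pdivrMr; lra.
have := extremal_ratio_max k'1 (ltW t0) (ltW t1).
have := extremal_ratio_argmax k1; rewrite -/t => e.
rewrite (_ : k' - 1 = (k - 1) - (k - k')); last ring.
rewrite powRB ?(gt_eqF t0) ?implybT // => le1.
have p0 := powR_gt0 (k - k') t0.
have f0 := extremal_ratio_gt0 k1.
have fe : extremal_ratio k * ((1 - t) * t `^ (k - 1)) = 1 by rewrite mulrC.
move: le1; rewrite -(ler_pM2l (mulr_gt0 f0 p0)) mulr1; congr (_ <= _).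
have -> : extremal_ratio k * t `^ (k - k') *
   ((1 - t) * (t `^ (k - 1) / t `^ (k - k')) * extremal_ratio k') =
  (extremal_ratio k * ((1 - t) * t `^ (k - 1))) * extremal_ratio k'
   * (t `^ (k - k') / t `^ (k - k')) by ring.
by rewrite fe divff ?gt_eqF // mul1r mulr1.
Qed.

Lemma extremal_ratio_incr k k' : 1 < k' -> k' < k ->
  extremal_ratio k' < extremal_ratio k.
Proof.
move=> k'1 k'k; have k1 : 1 < k by lra.
apply: le_lt_trans (extremal_ratio_le_pow k'1 k1) _.
rewrite gtr_pMr ?extremal_ratio_gt0 //.
have t0 : 0 < (k - 1) / k by rewrite divr_gt0; lra.
rewrite -ltr_ln ?posrE ?powR_gt0 ?ltr01 // ln1 ln_powR pmulr_rlt0; last lra.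
by rewrite ln_lt0 // t0 ltr_pdivrMr; lra.
Qed.

(** With s = (k' - 1) / k', the factor s^(k - k') is at least 1 + (k - k') ln s, and - ln s = ln (1
    + 1 / (k' - 1)) <= 1 because k' >= 2. *)
Lemma extremal_ratio_ge k k' : 2 <= k' -> k' <= k ->
  extremal_ratio k * (1 - (k - k')) <= extremal_ratio k'.
Proof.
move=> k'2 k'k; have k1 : 1 < k by lra.
have k'1 : 1 < k' by lra.
have t0 : 0 < (k' - 1) / k' by rewrite divr_gt0; lra.
have p0 := powR_gt0 (k' - k) t0.
have := extremal_ratio_le_pow k1 k'1.
rewrite -ler_pdivrMr //; apply: le_trans; rewrite ler_pM2l ?extremal_ratio_gt0 //.
rewrite -powRN opprB /powR gt_eqF //; apply: le_trans (expR_ge1Dx _).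
rewrite lerD2l -(opprB k k') opprK lerNl -mulrN ler_piMr //; first lra.
rewrite -lnV ?posrE // invfM invrK.
have i0 : 0 < (k' - 1)^-1 by rewrite invr_gt0; lra.
have := @le_ln1Dx R ((k' - 1)^-1).
have -> : 1 + (k' - 1)^-1 = (k' - 1)^-1 * k' by field; lra.
move=> h; apply: le_trans (h _) _; first lra.
by rewrite invf_le1; lra.
Qed.

End ExtremalRatio.

(** * Shearer's inequality *)

Section Hoelder.
Variables (R : realType) (X : finType).
Hypothesis X0 : (0 < #|X|)%N.

Definition mean (phi : X -> R) : R := (\sum_x phi x) / #|X|%:R.

Let cardX0 : (0 : R) < #|X|%:R. Proof. by rewrite ltr0n. Qed.

Lemma ler_mean phi psi : (forall x, phi x <= psi x) -> mean phi <= mean psi.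
Proof.
by move=> le; rewrite ler_pM2r ?invr_gt0 //; apply: ler_sum => x _.
Qed.

Lemma mean_ge0 phi : (forall x, 0 <= phi x) -> 0 <= mean phi.
Proof. by move=> phi0; rewrite mulr_ge0 ?invr_ge0 ?ler0n ?sumr_ge0. Qed.

Lemma mean_cst phi x : (forall y, phi y = phi x) -> mean phi = phi x.
Proof.
move=> c; rewrite /mean (eq_bigr (fun=> phi x)) // sumr_const.
by rewrite -[X in X / _]mulr_natr mulfK ?gt_eqF.
Qed.

Lemma meanZ c phi : mean (fun x => c * phi x) = c * mean phi.
Proof. by rewrite /mean -mulr_sumr mulrA. Qed.

Lemma mean_eq0 phi : (forall x, 0 <= phi x) -> mean phi = 0 ->
  forall x, phi x = 0.
Proof.
move=> phi0 /eqP; rewrite mulf_eq0 invr_eq0 (gt_eqF cardX0) orbF => /eqP.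
by move=> /psumr_eq0P h x; apply: h.
Qed.

(** Hoelder's inequality with equal exponents. In Shearer's induction it averages out one
    coordinate, [J] indexing the factors that may depend on it. *)
Lemma hoelder_mean (I : finType) (J : {pred I}) (phi : X -> R)
    (h : I -> X -> R) :
  (0 < #|J|)%N -> (forall x, 0 <= phi x) -> (forall i x, 0 <= h i x) ->
  (forall i x y, i \notin J -> h i x = h i y) ->
  (forall x, phi x ^+ #|J| <= \prod_i h i x) ->
  mean phi ^+ #|J| <= \prod_i mean (h i).
Proof.
move=> J0 phi0 h0 hcst phih.
(* If some [h i] has mean 0, it vanishes identically and so does [phi]; otherwise the means can be
   divided out. *)
have [/existsP[i /eqP hi0]|] := boolP [exists i, mean (h i) == 0].
  have phiz x : phi x = 0.
    have : phi x ^+ #|J| == 0.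
      rewrite eq_le exprn_ge0 // andbT (le_trans (phih x)) //.
      by rewrite (bigD1 i) //= (mean_eq0 (h0 i) hi0) mul0r.
    by rewrite expf_eq0 J0 => /eqP.
  rewrite /mean big1 // mul0r expr0n gtn_eqF //.
  by apply: prodr_ge0 => j _; exact: mean_ge0.
rewrite negb_exists => /forallP hn0.
have H0 i : 0 < mean (h i) by rewrite lt_def hn0 mean_ge0.
set P := \prod_i mean (h i); have P0 : 0 < P by apply: prodr_gt0.
pose D := P `^ (#|J|%:R)^-1.
have D0 : 0 < D by rewrite powR_gt0.
have DP : D ^+ #|J| = P.
  by rewrite -powR_mulrn ?ltW // -powRrM mulVf ?pnatr_eq0 -?lt0n // powRr1 // ltW.
rewrite -DP lerXn2r ?nnegrE ?mean_ge0 ?(ltW D0) //.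
(* AM-GM over [J] for the normalised functions [h i / mean (h i)]; those outside
   [J] are constant, equal to 1. *)
pose avg x := (\sum_(i in J) h i x / mean (h i)) / #|J|%:R.
have phiD x : phi x <= D * avg x.
  have avg0 : 0 <= avg x.
    by rewrite divr_ge0 // sumr_ge0 // => i _; rewrite divr_ge0 // ltW.
  have Davg0 : 0 <= D * avg x by exact: mulr_ge0 (ltW D0) avg0.
  rewrite -(@ler_pXn2r _ #|J|) ?nnegrE //.
  rewrite exprMn DP (le_trans (phih x)) // -ler_pdivrMl // -prodfV -big_split /=.
  rewrite [leLHS](_ : _ = \prod_(i in J) (h i x / mean (h i))); last first.
    rewrite (bigID (mem J)) /= [X in _ * X]big1 ?mulr1 => [|i iJ].
      by apply: eq_bigr => i _; rewrite mulrC.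
    have -> : h i x = mean (h i) by rewrite (@mean_cst _ x) // => y; exact: hcst.
    by rewrite mulVf.
  have hH0 i : 0 <= h i x / mean (h i) by rewrite divr_ge0 // ltW.
  by have [] := leif_AGM (A := J) (fun i _ => hH0 i).
apply: le_trans (ler_mean phiD) _; rewrite meanZ ler_piMr ?(ltW D0) //.
rewrite /avg [leLHS](_ : _ = (\sum_(i in J) mean (h i) / mean (h i)) / #|J|%:R).
  rewrite (eq_bigr (fun=> 1)) => [|i _]; last by rewrite divff // gt_eqF.
  by rewrite sumr_const divff // pnatr_eq0 -lt0n.
rewrite /mean -mulr_suml exchange_big /=.
rewrite mulrAC mulr_suml; congr (_ / _).
by apply: eq_bigr => i _; rewrite -mulr_suml mulrAC.
Qed.

End Hoelder.

Section Shearer.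
Variables (R : realType) (X I : finType) (q : nat).
Hypotheses (X0 : (0 < #|X|)%N) (q0 : (0 < q)%N).

Definition tmean m (F : m.-tuple X -> R) : R := (\sum_t F t) / (#|X| ^ m)%:R.

Lemma tmean0 (F : 0.-tuple X -> R) : tmean F = F [tuple].
Proof.
rewrite /tmean expn0 divr1 (eq_bigr (fun=> F [tuple])) => [|t _].
  by rewrite sumr_const card_tuple expn0.
by rewrite tuple0.
Qed.

Lemma tmeanS m (F : m.+1.-tuple X -> R) :
  tmean F = mean (fun x => tmean (fun t => F (cons_tuple x t))).
Proof.
rewrite /tmean /mean -mulr_suml -mulrA -invfM -natrM mulnC -expnS; congr (_ / _).
rewrite pair_big /=.
rewrite (reindex (fun p : X * m.-tuple X => cons_tuple p.1 p.2)) //=.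
exists (fun t : m.+1.-tuple X => (thead t, behead_tuple t)) => [[x t] _|t _] /=.
  by congr pair; apply: val_inj.
by rewrite [RHS]tuple_eta; exact: val_inj.
Qed.

Lemma tmean_ge0 m (F : m.-tuple X -> R) : (forall t, 0 <= F t) -> 0 <= tmean F.
Proof. by move=> F0; rewrite divr_ge0 // sumr_ge0. Qed.

(* [dep i j] marks the coordinates on which [g i] is allowed to depend. *)
Lemma shearer m (dep : I -> pred nat) (F : m.-tuple X -> R)
    (g : I -> m.-tuple X -> R) :
  (forall j, (j < m)%N -> #|[pred i | dep i j]| = q) ->
  (forall t, 0 <= F t) -> (forall i t, 0 <= g i t) ->
  (forall i t t', (forall j : 'I_m, dep i j -> tnth t j = tnth t' j) ->
     g i t = g i t') ->
  (forall t, F t ^+ q <= \prod_i g i t) ->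
  tmean F ^+ q <= \prod_i tmean (g i).
Proof.
elim: m dep F g => [|m IH] dep F g cover F0 g0 gdep Fg.
  by rewrite tmean0 (eq_bigr (fun i => g i [tuple])) // => i _; rewrite tmean0.
rewrite tmeanS; under eq_bigr => i _ do rewrite tmeanS.
(* The exponent becomes the number of factors that may depend on the first coordinate. After
   Hoelder, each fibre is the induction hypothesis with [dep] shifted. *)
rewrite -(cover 0%N isT).
apply: hoelder_mean => //; first by rewrite cover.
- by move=> x; exact: tmean_ge0.
- by move=> i x; exact: tmean_ge0.
- move=> i x y; rewrite inE => idep; congr (_ / _); apply: eq_bigr => t _.
  apply: gdep => j; have [j' ->|->] := unliftP ord0 j; first by rewrite !tnthS.
  by rewrite (negPf idep).
move=> x; rewrite cover //.
apply: (IH (fun i j => dep i j.+1)) => //; first by move=> j jm; exact: cover.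
move=> i t t' tt'; apply: gdep => j.
have [j' ->|->] := unliftP ord0 j; last by rewrite !tnth0.
by rewrite !tnthS => d; apply: tt'; rewrite lift0 in d.
Qed.

End Shearer.

(** * Fractional colorings *)

Section FractionalColorings.
Variables (R : realType) (G : digraph).
Implicit Types (x : {set G} -> R) (k : R) (u v : G) (A : {set G}).

Lemma frac_chromatic_le x : fractional_coloring x ->
  frac_chromatic G R <= total_weight x.
Proof.
move=> xF; apply: ge_inf; last by exists x.
by exists 0 => _ [y [y0 _] <-]; apply: sumr_ge0 => A; exact: y0.
Qed.

Lemma dir_local_frac_chromatic_le x k : 1 <= k -> fractional_coloring x ->
  (forall v, 1 + out_weight x v <= k) -> dir_local_frac_chromatic G R <= k.
Proof.
move=> k1 xF xk; apply: (@le_trans _ _ (local_weight x)).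
  apply: ge_inf; last by exists x.
  by exists 1 => _ [y _ <-]; rewrite lerDl bigmax_ge_id.
rewrite -lerBrDl; apply: bigmax_le => [|v _]; first by rewrite subr_ge0.
by rewrite lerBrDl.
Qed.

Lemma out_weight_le x v : 1 + out_weight x v <= local_weight x.
Proof. by rewrite lerD2l le_bigmax. Qed.

(** Distinct indices may have the same class; their weights then add up. *)
Definition class_weight (C : finType) (w : C -> R) (cls : C -> {set G}) A : R :=
  \sum_(c | cls c == A) w c.

Section ClassWeight.
Variables (C : finType) (w : C -> R) (cls : C -> {set G}).
Hypothesis cls_indep : forall c, cls c \in indep_sets G.

Lemma sum_class_weight (P : pred {set G}) :
  \sum_(A in indep_sets G | P A) class_weight w cls A = \sum_(c | P (cls c)) w c.
Proof.
rewrite (partition_big cls [pred A | (A \in indep_sets G) && P A]) /=; last first.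
  by move=> c ->; rewrite cls_indep.
apply: eq_bigr => A /andP[_ PA]; apply: eq_bigl => c.
by case: eqP => [->|_]; rewrite ?PA ?andbF.
Qed.

Lemma total_class_weight : total_weight (class_weight w cls) = \sum_c w c.
Proof.
rewrite -(sum_class_weight xpredT); by apply: eq_bigl => A; rewrite andbT.
Qed.

Lemma class_weight_fractional : (forall c, 0 <= w c) ->
  (forall v, 1 <= \sum_(c | v \in cls c) w c) ->
  fractional_coloring (class_weight w cls).
Proof.
move=> w0 w1; split=> [A _|v]; first by rewrite sumr_ge0.
by rewrite (sum_class_weight (fun A => v \in A)).
Qed.

Lemma out_class_weight v : out_weight (class_weight w cls) v =
  \sum_(c | (out_neighbors v :&: cls c)%SET != finset.set0) w c.
Proof.
exact: (sum_class_weight (fun A => (out_neighbors v :&: A)%SET != finset.set0)).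
Qed.

End ClassWeight.

Lemma indep_setsP A :
  reflect (forall u v, u \in A -> v \in A -> ~~ Defs.arc u v) (A \in indep_sets G).
Proof.
rewrite inE; apply: (iffP forall_inP) => [h u v uA vA|h u uA].
  by have /forall_inP/(_ _ vA) := h _ uA; rewrite /adj negb_or => /andP[].
by apply/forall_inP => v vA; rewrite /adj negb_or !h.
Qed.

(* Double counting of the pairs of a vertex and a class containing it, the
   classes being weighted. *)
Lemma frac_chromatic_ge (a : R) : 0 < a ->
  (forall A, A \in indep_sets G -> #|A|%:R <= a) ->
  #|G|%:R / a <= frac_chromatic G R.
Proof.
move=> a0 Aa; have [x [x0 x1] <-] := frac_chromatic_attained G R.
rewrite ler_pdivrMr //.
apply: (@le_trans _ _ (\sum_(v : G) \sum_(A in indep_sets G | v \in A) x A)).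
  rewrite -sum1_card natr_sum; apply: ler_sum => v _; exact: x1.
under eq_bigr do rewrite big_mkcondr /=.
rewrite exchange_big /= mulr_suml; apply: ler_sum => A AI.
rewrite -big_mkcond sumr_const -[leLHS]mulr_natr.
by rewrite ler_wpM2l ?x0 ?Aa.
Qed.

(** The color classes of an optimal coloring, each of weight 1, form a fractional coloring whose
    out-weights count the colors seen. *)
Lemma dir_local_frac_chromatic_le_int :
  dir_local_frac_chromatic G R <= (dir_local_chromatic G)%:R.
Proof.
rewrite /dir_local_chromatic; case: ex_minnP => m /asboolP[c cP ->] _.
pose M := (\max_(v : G) c v)%N.
have cM v : (c v < M.+1)%N by rewrite ltnS; exact: leq_bigmax.
pose cls (i : 'I_M.+1) : {set G} := [set v | c v == i]%SET.
have cls_indep i : cls i \in indep_sets G.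
  apply/indep_setsP => u v; rewrite !inE => /eqP cu /eqP cv.
  by apply/negP => uv; have := cP u v; rewrite /adj uv cu cv eqxx => /(_ isT).
apply: (@dir_local_frac_chromatic_le (class_weight (fun=> 1) cls)).
- by rewrite ler1n.
- apply: class_weight_fractional => // v.
  rewrite (bigD1 (Ordinal (cM v))) /=; last by rewrite inE.
  by rewrite lerDl sumr_ge0.
move=> v; rewrite out_class_weight // sumr_const -mulrS ler_nat ltnS.
apply: leq_trans (leq_bigmax v).
rewrite cardE -(size_map val); apply: uniq_leq_size.
  by rewrite map_inj_uniq ?enum_uniq //; exact: val_inj.
move=> _ /mapP[i + ->]; rewrite mem_enum => /set0Pn[u].
rewrite !inE mem_undup => /andP[vu /eqP cu].
by rewrite (_ : val i = c u) // map_f // mem_enum inE.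
Qed.

End FractionalColorings.

(** * Random families of independent sets and the upper bound *)

Section RandomSelection.
Variables (R : realType) (T : finType) (r : T -> R).

(* The probability that the random set [S] is obtained when each [i] is left
   out of [S] independently with probability [r i]. *)
Definition selection_weight (S : {set T}) : R :=
  \prod_i (if i \in S then 1 - r i else r i).

(** Expanding a product of sums with the inclusion factor set to 0 on [F] kills exactly the terms of
    the sets meeting [F]. *)
Lemma selection_weight_avoid (F : {set T}) :
  \sum_(S : {set T} | [disjoint S & F]) selection_weight S = \prod_(i in F) r i.
Proof.
transitivity (\prod_i ((if i \in F then 0 else 1 - r i) + r i)).
  rewrite bigA_distr /= big_mkcond; apply: eq_bigr => S _.
  case: ifPn => [/pred0P SF|/pred0Pn[i /andP[/= iS iF]]].
    apply: eq_bigr => i _; case: ifPn => // iS; case: ifPn => // iF.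
    by have := SF i; rewrite /= iS iF.
  by rewrite (bigD1 i) //= iS iF mul0r.
rewrite [RHS]big_mkcond; apply: eq_bigr => i _.
by case: ifPn; rewrite ?add0r // subrK.
Qed.

End RandomSelection.

(* Draw a random family [S] of independent sets, each [A] being left out with
   probability [t `^ x A], and keep the vertices lying in a member of [S] no
   out-neighbour of which lies in a member of [S]. The kept vertices are
   independent, and each vertex is kept with probability at least
   [(1 - t) * t `^ (k - 1)]. *)
Lemma frac_chromatic_le_extremal (R : realType) (G : digraph) (k : R)
    (x : {set G} -> R) :
  1 < k -> fractional_coloring x -> local_weight x <= k ->
  frac_chromatic G R <= extremal_ratio k.
Proof.
move=> k1 [x0 x1] xk; pose t := (k - 1) / k.
have t0 : 0 < t by rewrite divr_gt0; lra.
have t1 : t < 1 by rewrite ltr_pdivrMr; lra.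
pose Cv v : {set {set G}} := [set A in indep_sets G | v \in A]%SET.
pose Ov v : {set {set G}} :=
  [set A in indep_sets G | (out_neighbors v :&: A)%SET != finset.set0]%SET.
pose cls (S : {set {set G}}) : {set G} :=
  [set v | ~~ [disjoint S & Cv v] & [disjoint S & Ov v]]%SET.
have cls_indep S : cls S \in indep_sets G.
  apply/indep_setsP => u v; rewrite !inE => /andP[_ uO] /andP[vC _].
  apply/negP => uv; move: vC => /pred0Pn[A /= /andP[AS]].
  rewrite inE => /andP[AI vA]; move: uO => /pred0P/(_ A) /=; rewrite AS inE AI /=.
  by move=> /negbT /negP[]; apply/set0Pn; exists v; rewrite !inE uv.
(* The value 1 ensures that sets that are not independent are never selected. *)
pose r A := if A \in indep_sets G then t `^ x A else 1.
have r01 A : 0 <= r A <= 1.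
  rewrite /r; case: ifPn => AI; last by rewrite ler01 lexx.
  rewrite powR_ge0 -(powRr0 t) ger_powR ?x0 // t0 ltW //.
have prodr (P : pred {set G}) :
    \prod_(A in [set A in indep_sets G | P A]%SET) r A =
    t `^ (\sum_(A in indep_sets G | P A) x A).
  rewrite (eq_bigl (fun A => (A \in indep_sets G) && P A)); last first.
    by move=> A; rewrite inE.
  elim/big_rec2: _ => [|A s p /andP[AI _] ->]; first by rewrite powRr0.
  by rewrite powRD ?(gt_eqF t0) ?implybT // /r AI.
have sw0 S : 0 <= selection_weight r S.
  apply: prodr_ge0 => A _; case: ifP => _; last by have /andP[] := r01 A.
  by rewrite subr_ge0; have /andP[] := r01 A.
have f0 := extremal_ratio_gt0 k1.
pose w S := extremal_ratio k * selection_weight r S.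
have tot : \sum_S w S = extremal_ratio k.
  rewrite -mulr_sumr -[RHS]mulr1; congr (_ * _).
  have := selection_weight_avoid r finset.set0.
  rewrite big_set0 => <-; apply: eq_bigl => S.
  by apply/esym/pred0P => A /=; rewrite inE andbF.
rewrite -tot -(total_class_weight w cls_indep).
apply: frac_chromatic_le; apply: class_weight_fractional => //.
  by move=> S; rewrite mulr_ge0 ?sw0 ?ltW.
move=> v; rewrite -mulr_sumr.
(* Disjointness makes meeting [Cv v] and avoiding [Ov v] independent events. *)
have COdisj : [disjoint Cv v & Ov v].
  apply/pred0P => A /=; apply/negP => /andP[]; rewrite inE => /andP[AI vA].
  rewrite inE => /andP[_ /set0Pn[u]]; rewrite !inE => /andP[vu uA].
  by have /indep_setsP/(_ _ _ vA uA) := AI; rewrite vu.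
have keep : \sum_(S | v \in cls S) selection_weight r S =
    \prod_(A in Ov v) r A * (1 - \prod_(A in Cv v) r A).
  have avoid2 : \prod_(A in Ov v) r A * \prod_(A in Cv v) r A =
      \sum_(S : {set _} | [disjoint S & Ov v] && [disjoint S & Cv v])
         selection_weight r S.
    rewrite mulrC -bigU // -(eq_bigl _ _ (fun A => finset.in_setU A (Cv v) (Ov v))).
    rewrite -selection_weight_avoid; apply: eq_bigl => S.
    rewrite andbC ![[disjoint S & _]]disjoint_sym -disjointU.
    by apply: eq_disjoint => A; rewrite finset.in_setU.
  rewrite mulrBr mulr1 avoid2 -selection_weight_avoid.
  rewrite [X in _ = X - _](bigID (fun S : {set _} => [disjoint S & Cv v])) /=.
  rewrite [RHS]addrC addKr.
  by apply: eq_bigl => S; rewrite !inE andbC.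
rewrite keep !prodr mulrC -[leLHS](extremal_ratio_argmax k1) -/t.
rewrite ler_wpM2r ?(ltW f0) //.
(* As t < 1, the out-weight being at most k - 1 bounds one factor, and the weight covering [v] being
   at least 1 bounds the other. *)
rewrite mulrC ler_pM ?powR_ge0 ?subr_ge0 ?(ltW t1) //.
  rewrite ger_powR ?t0 ?(ltW t1) //.
  by rewrite -(lerD2l 1) (le_trans (out_weight_le x v)) //; lra.
rewrite lerD2l lerN2 -[leRHS]powRr1 ?(ltW t0) // ger_powR ?t0 ?(ltW t1) //.
Qed.

(** * Extremal graphs *)

Section UniversalGraph.
Variables n q m : nat.

(* The tuple lengths are [q.+1] and [m.+1], so that they are positive. *)
Definition tuple_pair_pred :=
  [pred v : q.+1.-tuple 'I_n * m.+1.-tuple 'I_n |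
    uniq v.1 && all (fun i => i \notin v.1) v.2].

Definition tuple_pair :=
  {v : q.+1.-tuple 'I_n * m.+1.-tuple 'I_n | tuple_pair_pred v}.

Definition tuple_arc : rel tuple_pair :=
  fun v w => all (mem (val v).2) (val w).1.

Lemma tuple_arc_irrefl : irreflexive tuple_arc.
Proof.
move=> [[a b] /= vP]; have /andP[_ /allP ab] := vP; apply/negbTE/allPn.
by exists (thead a); [exact: mem_tnth|apply/negP => /ab/negP[]; exact: mem_tnth].
Qed.

Definition tuple_graph : digraph := @Digraph tuple_pair tuple_arc tuple_arc_irrefl.

(** Cutting a tuple of distinct entries after its first [q.+1] entries gives a vertex,
    injectively. *)
Lemma card_tuple_graph : (n ^_ (q.+1 + m.+1) <= #|tuple_graph|)%N.
Proof.
pose U := [set t : (q.+1 + m.+1).-tuple 'I_n | all xpredT t & uniq t]%SET.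
have <- : #|U| = (n ^_ (q.+1 + m.+1))%N by rewrite card_uniq_tuples card_ord.
pose h (t : (q.+1 + m.+1).-tuple 'I_n) :
    q.+1.-tuple 'I_n * m.+1.-tuple 'I_n :=
  ([tuple tnth t (lshift _ i) | i < q.+1], [tuple tnth t (rshift _ i) | i < m.+1]).
have hK t : (h t).1 ++ (h t).2 = t :> seq _.
  suff: [tuple of (h t).1 ++ (h t).2] = t by move=> /(congr1 val).
  apply: eq_from_tnth => k; rewrite -(splitK k).
  case: (fintype.split k) => i; rewrite ?tnth_lshift ?tnth_rshift tnth_mktuple //.
rewrite -(card_in_imset (f := h)).
  rewrite card_sig; apply/subset_leq_card/fintype.subsetP => _ /imsetP[t + ->].
  rewrite inE => /andP[_]; rewrite -hK cat_uniq inE => /and3P[u1 hh _].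
  by rewrite /tuple_pair_pred inE u1 -all_predC in hh *.
by move=> t t' _ _ tt'; apply: val_inj; rewrite /= -hK tt' hK.
Qed.

Variable R : realType.

Definition tuple_cls (i : 'I_n) : {set tuple_graph} :=
  [set v : tuple_graph | i \in (val v).1]%SET.

Lemma tuple_cls_indep i : tuple_cls i \in indep_sets tuple_graph.
Proof.
apply/indep_setsP => -[[a b] /= vP] [[a' b'] /= wP]; rewrite !inE /= => ia ia'.
apply/negP => /allP/(_ _ ia') ib; have /andP[_ /allP/(_ _ ib)] := vP.
by rewrite ia.
Qed.

Lemma tuple_graph_local_frac_chromatic :
  dir_local_frac_chromatic tuple_graph R <= 1 + m.+1%:R / q.+1%:R.
Proof.
pose w (i : 'I_n) : R := q.+1%:R^-1.
apply: (dir_local_frac_chromatic_le (x := class_weight w tuple_cls)).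
- by rewrite lerDl divr_ge0.
- apply: class_weight_fractional => [||v].
  + exact: tuple_cls_indep.
  + by move=> i; rewrite invr_ge0.
  have /andP[uv _] := valP v; rewrite sumr_const -[leRHS]mulr_natr.
  rewrite (eq_card (B := mem (val v).1)) => [|i].
    by rewrite (card_uniqP uv) size_tuple mulVf.
  by rewrite -[LHS]/(v \in tuple_cls i) inE.
move=> v; rewrite lerD2l out_class_weight; last exact: tuple_cls_indep.
rewrite sumr_const -[leLHS]mulr_natr mulrC ler_wpM2r ?invr_ge0 // ler_nat.
rewrite -[leqRHS](size_tuple (val v).2).
apply: leq_trans (subset_leq_card _) (card_size (val v).2).
apply/fintype.subsetP => i /set0Pn[u].
by rewrite !inE => /andP[/allP/(_ i) h] /h.
Qed.

(** Color (a, b) by the first entry of a: the out-neighbors then only use entries of b as colors. *)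
Lemma tuple_graph_local_chromatic : (dir_local_chromatic tuple_graph <= m.+2)%N.
Proof.
rewrite /dir_local_chromatic; case: ex_minnP => d _ dmin.
pose c (v : tuple_graph) : nat := thead (val v).1.
have arc_c (v w : tuple_graph) : Defs.arc v w -> thead (val w).1 \in (val v).2.
  by move=> /allP; apply; exact: mem_tnth.
have arc_neq (v w : tuple_graph) : Defs.arc v w -> c v != c w.
  move=> vw; have /andP[_ /allP/(_ _ (arc_c _ _ vw))] := valP v.
  by apply: contraNneq => /val_inj <-; exact: mem_tnth.
have cP : proper_coloring c.
  by move=> v w /orP[/arc_neq //|/arc_neq]; rewrite eq_sym.
apply: (@leq_trans (max_out_colors c).+1).
  by apply: dmin; apply/asboolP; exists c.
rewrite ltnS; apply/bigmax_leqP => v _.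
rewrite -[leqRHS](size_tuple (val v).2) -(size_map val).
apply: uniq_leq_size (undup_uniq _) _ => x; rewrite mem_undup => /mapP[w].
rewrite mem_enum inE => vw ->; exact: map_f (arc_c _ _ vw).
Qed.

(** * The size of independent sets in the tuple graph *)

Section IndepSet.
Variable A : {set tuple_graph}.
Hypothesis AI : A \in indep_sets tuple_graph.
Hypothesis qm : (q <= m)%N.

Let N1 : {set q.+1.-tuple 'I_n} := [set (val v).1 | v in A]%SET.
Let N2 : {set m.+1.-tuple 'I_n} := [set (val v).2 | v in A]%SET.

Lemma card_indep_le_proj : (#|A| <= #|N1| * #|N2|)%N.
Proof.
rewrite -cardsX -(card_imset A (f := val)); last exact: val_inj.
apply/subset_leq_card/fintype.subsetP => _ /imsetP[v vA ->].
by rewrite inE; apply/andP; split; apply/imsetP; exists v.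
Qed.

(** Addition in ['I_m.+1] is modulo [m.+1], so that windows wrap around. *)
Definition window (i : 'I_m.+1) (b : m.+1.-tuple 'I_n) : q.+1.-tuple 'I_n :=
  [tuple tnth b (i + widen_ord (qm : (q.+1 <= m.+1)%N) j) | j < q.+1].

Lemma window_notin i b : b \in N2 -> window i b \notin N1.
Proof.
move=> /imsetP[v vA ->]; apply/negP => /imsetP[w wA e].
have /indep_setsP/(_ _ _ vA wA)/negP := AI; apply.
by apply/allP => x; rewrite -e => /mapP[j _ ->]; exact: mem_tnth.
Qed.

Hypothesis n0 : (0 < n)%N.

Lemma tmean_prefix (p l : nat) (lpl : (p <= l)%N) (F : p.-tuple 'I_n -> R) :
  tmean (fun t : l.-tuple 'I_n => F [tuple tnth t (widen_ord lpl j) | j < p]) =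
  tmean F.
Proof.
elim: p l lpl F => [|p IH] [|l] lpl F //.
- by rewrite !tmean0; congr F; rewrite !tuple0.
- rewrite tmean0 /tmean (eq_bigr (fun=> F [tuple])) => [|t _].
    rewrite sumr_const card_tuple -[X in X / _]mulr_natr mulfK //.
    by rewrite pnatr_eq0 -lt0n expn_gt0 card_ord n0.
  by rewrite tuple0.
rewrite !tmeanS; congr (_ / _); apply: eq_bigr => x _.
rewrite -(IH l lpl); congr (_ / _); apply: eq_bigr => t _; congr F.
apply: eq_from_tnth => j; rewrite tnth_mktuple.
have [j' ->|->] := unliftP ord0 j.
  by rewrite tnthS tnth_mktuple -[RHS](tnthS x); congr (tnth _ _); apply: val_inj.
by rewrite [RHS]tnth0 (_ : widen_ord _ _ = ord0) ?tnth0 //; apply: val_inj.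
Qed.

(** A cyclic shift of the coordinates permutes the tuples and carries the window to the prefix. *)
Lemma tmean_window i (F : q.+1.-tuple 'I_n -> R) :
  tmean (fun b => F (window i b)) = tmean F.
Proof.
rewrite -(tmean_prefix (qm : (q.+1 <= m.+1)%N)).
pose shift (k : 'I_m.+1) (b : m.+1.-tuple 'I_n) := [tuple tnth b (k + j) | j < m.+1].
have shiftK : cancel (shift (- i)) (shift i).
  move=> b; apply: eq_from_tnth => j.
  by rewrite !tnth_mktuple addrA addNr add0r.
congr (_ / _); rewrite [LHS](reindex_inj (can_inj shiftK)) /=.
apply: eq_bigr => b _; congr F; apply: eq_from_tnth => j.
by rewrite !tnth_mktuple addrA addNr add0r.
Qed.

Lemma tmean_indicator p (B : {set p.-tuple 'I_n}) :
  tmean (fun t => (t \in B)%:R) = #|B|%:R / (n ^ p)%:R :> R.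
Proof.
rewrite /tmean card_ord; congr (_ / _).
rewrite -sum1_card natr_sum [RHS]big_mkcond; apply: eq_bigr => t _.
by case: (t \in B).
Qed.

(** Position j lies in window i when j - i, modulo [m.+1], is below [q.+1]; and i |-> j - i is an
    involution. *)
Lemma window_cover (j : nat) : (j < m.+1)%N ->
  #|[pred i : 'I_m.+1 | ((inord j - i : 'I_m.+1)%R < q.+1)%N]| = q.+1.
Proof.
move=> jm; rewrite -sum1_card.
have subK : involutive (fun i : 'I_m.+1 => inord j - i) by move=> i; rewrite subKr.
rewrite (reindex_inj (inv_inj subK)).
rewrite (eq_bigl (fun i : 'I_m.+1 => (i < q.+1)%N)) => [|i]; last first.
  by rewrite -[LHS]/((inord j - (inord j - i) : 'I_m.+1)%R < q.+1)%N subKr.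
by rewrite (big_ord_narrow (qm : (q.+1 <= m.+1)%N)) sum_nat_const card_ord muln1.
Qed.

(** Shearer's inequality for the indicator of [N2], bounded by the indicators that the windows lie
    outside [N1]; each of these has mean one minus the density of [N1]. *)
Lemma proj_density :
  (#|N2|%:R / (n ^ m.+1)%:R) ^+ q.+1 <=
  (1 - #|N1|%:R / (n ^ q.+1)%:R) ^+ m.+1 :> R.
Proof.
have nX0 : (0 < #|'I_n|)%N by rewrite card_ord.
pose g (i : 'I_m.+1) (b : m.+1.-tuple 'I_n) : R := (window i b \notin N1)%:R.
have := @shearer R 'I_n 'I_m.+1 q.+1 nX0 isT m.+1
  (fun i j => ((inord j - i : 'I_m.+1)%R < q.+1)%N) (fun b => (b \in N2)%:R) g.
rewrite tmean_indicator (eq_bigr (fun=> 1 - #|N1|%:R / (n ^ q.+1)%:R)) => [|i _].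
  rewrite prodr_const card_ord; apply=> //.
  - exact: window_cover.
  - move=> i t t' tt'; rewrite /g; suff -> : window i t = window i t' by [].
    apply: eq_from_tnth => j.
    rewrite !tnth_mktuple; apply: tt'; rewrite inord_val addrC addKr.
    exact: (ltn_ord j).
  move=> t; have [tN2|_] := boolP (t \in N2); last first.
    by rewrite expr0n prodr_ge0.
  by rewrite expr1n big1 // => i _; rewrite /g window_notin.
rewrite (tmean_window i (fun a => (a \notin N1)%:R)).
have -> : (fun a => (a \notin N1)%:R) = (fun a => (a \in ~: N1)%SET%:R) :> (_ -> R).
  by apply/funext => a; rewrite inE.
rewrite tmean_indicator; have := cardsC N1; rewrite card_tuple card_ord => <-.
rewrite natrD -[X in X - _](@divff _ (#|N1|%:R + #|~: N1|%SET%:R)).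
  by rewrite -mulrBl addrAC subrr add0r.
rewrite -natrD; have := cardsC N1; rewrite card_tuple card_ord => ->.
by rewrite pnatr_eq0 -lt0n expn_gt0 n0.
Qed.

Lemma card_indep_tuple_graph :
  #|A|%:R * extremal_ratio (1 + m.+1%:R / q.+1%:R) <= (n ^ (q.+1 + m.+1))%:R :> R.
Proof.
set c : R := m.+1%:R / q.+1%:R; have c0 : 0 < c by rewrite divr_gt0.
have np p : 0 < (n ^ p)%:R :> R by rewrite ltr0n expn_gt0 n0.
pose alpha : R := #|N1|%:R / (n ^ q.+1)%:R.
pose beta : R := #|N2|%:R / (n ^ m.+1)%:R.
have alpha0 : 0 <= alpha by rewrite divr_ge0.
have beta0 : 0 <= beta by rewrite divr_ge0.
have alpha1 : alpha <= 1.
  rewrite ler_pdivrMr // mul1r ler_nat; apply: leq_trans (max_card _) _.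
  by rewrite card_tuple card_ord.
have nu0 : 0 <= 1 - alpha by rewrite subr_ge0.
have betaP : beta <= (1 - alpha) `^ c.
  rewrite -(@ler_pXn2r _ q.+1) // ?nnegrE ?powR_ge0 //.
  rewrite -[leRHS]powR_mulrn ?powR_ge0 // -powRrM divfK ?pnatr_eq0 //.
  by rewrite powR_mulrn //; exact: proj_density.
have f0 : 0 < extremal_ratio (1 + c) by rewrite extremal_ratio_gt0 // ltrDl.
have : alpha * beta * extremal_ratio (1 + c) <= 1.
  have nu1 : 1 - alpha <= 1 by rewrite gerBl.
  have c1 : 1 < 1 + c by rewrite ltrDl.
  (* The maximum is compared with the value at t = 1 - [alpha]. *)
  apply: le_trans (extremal_ratio_max c1 nu0 nu1).
  by rewrite subKr addrAC subrr add0r ler_wpM2r ?(ltW f0) // ler_wpM2l.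
rewrite -(ler_pM2r (np (q.+1 + m.+1)%N)) mul1r; apply: le_trans.
rewrite mulrAC ler_wpM2r ?(ltW f0) // expnD natrM mulrACA.
by rewrite !divfK ?gt_eqF // -natrM ler_nat card_indep_le_proj.
Qed.

End IndepSet.

Lemma tuple_graph_frac_chromatic : (0 < n)%N -> (q <= m)%N ->
  extremal_ratio (1 + m.+1%:R / q.+1%:R) *
    ((n ^_ (q.+1 + m.+1))%:R / (n ^ (q.+1 + m.+1))%:R) <=
  frac_chromatic tuple_graph R.
Proof.
move=> n0 qm; set f := extremal_ratio _.
have f0 : 0 < f by rewrite extremal_ratio_gt0 // ltrDl divr_gt0.
have N0 : 0 < (n ^ (q.+1 + m.+1))%:R :> R by rewrite ltr0n expn_gt0 n0.
have a0 := divr_gt0 N0 f0.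
apply: le_trans (frac_chromatic_ge a0 _) => [|A AI].
  rewrite invf_div [leRHS]mulrCA ler_pM2l // ler_pM2r ?invr_gt0 // ler_nat.
  exact: card_tuple_graph.
by rewrite ler_pdivlMr //; exact: card_indep_tuple_graph.
Qed.

End UniversalGraph.

(** * Sharp examples and conclusion *)

(** With denominators cleared, this says that a random N-tuple has a repetition with probability at
    most N^2 / n. *)
Lemma ler_exp_ffact (R : realDomainType) (n N : nat) : (N <= n)%N ->
  n%:R ^+ N * (n%:R - N%:R ^+ 2) <= (n ^_ N)%:R * n%:R :> R.
Proof.
elim: N => [|N IH] Nn; first by rewrite expr0n subr0 expr0 ffactn0.
have := IH (ltnW Nn).
rewrite ffactnSr natrM natrB ?(ltnW Nn) // [_ ^+ N.+1]exprSr.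
have : 0 <= (n%:R : R) ^+ N by rewrite exprn_ge0.
have : N%:R + 1 <= n%:R :> R by rewrite natr1 ler_nat.
have : 0 <= N%:R :> R by [].
rewrite -[N.+1%:R]natr1; move: ((n%:R : R) ^+ N) => P.
move: ((n ^_ N)%:R : R) (n%:R : R) (N%:R : R) => F x y y0 yx P0 PF.
have : P * (x - y ^+ 2) * (x - y) <= F * x * (x - y) by rewrite ler_wpM2r //; lra.
rewrite [F * (x - y) * x]mulrAC; apply: le_trans.
(* The two sides, without P, differ by x y + x + y^3. *)
rewrite -!mulrA ler_wpM2l //; nra.
Qed.

Lemma tuple_graph_approx (R : realType) (q m : nat) (eps : R) :
  (q <= m)%N -> 0 < eps ->
  exists n, extremal_ratio (1 + m.+1%:R / q.+1%:R) - eps <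
    frac_chromatic (tuple_graph n q m) R.
Proof.
move=> qm eps0; set f := extremal_ratio _.
have f0 : 0 < f by rewrite extremal_ratio_gt0 // ltrDl divr_gt0.
pose N := (q.+1 + m.+1)%N.
have b0 : 0 <= N%:R ^+ 2 * f / eps.
  by rewrite divr_ge0 ?(ltW eps0) // mulr_ge0 ?(ltW f0) // exprn_ge0.
(* This makes the loss f N^2 / n smaller than [eps]. *)
pose n := (N + Num.bound (N%:R ^+ 2 * f / eps))%N; exists n.
have Nn : (N <= n)%N by exact: leq_addr.
have n0 : (0 < n)%N by exact: leq_trans Nn.
have nR0 : 0 < n%:R :> R by rewrite ltr0n.
have nb : N%:R ^+ 2 * f / eps < n%:R.
  by rewrite (lt_le_trans (archi_boundP b0)) // ler_nat leq_addl.
apply: lt_le_trans (tuple_graph_frac_chromatic R n0 qm); rewrite -/f -/N.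
have nN0 : 0 < (n%:R : R) ^+ N by rewrite exprn_gt0.
have ratio : 1 - N%:R ^+ 2 / n%:R <= (n ^_ N)%:R / (n ^ N)%:R :> R.
  rewrite natrX ler_pdivlMr // -(ler_pM2r nR0).
  apply: le_trans (ler_exp_ffact R Nn); rewrite -mulrA mulrCA ler_pM2l //.
  by rewrite mulrBl mul1r divfK ?gt_eqF.
apply: lt_le_trans (ler_wpM2l (ltW f0) ratio).
rewrite mulrBr mulr1 ltrD2l ltrN2 mulrCA mulrA ltr_pdivrMr //.
by rewrite -ltr_pdivrMl // mulrC.
Qed.

Lemma frac_chromatic_le_local (R : realType) (G : digraph) (k : R) : 1 < k ->
  dir_local_frac_chromatic G R <= k -> frac_chromatic G R <= extremal_ratio k.
Proof.
have [x xF <-] := dir_local_frac_chromatic_attained G R.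
by move=> k1; exact: frac_chromatic_le_extremal.
Qed.

(* For an integer [k], part (a) and the monotonicity of the bound force
   [dir_local_chromatic] to exceed [k - 1]. *)
Lemma exists_sharp_int (R : realType) (m : nat) (eps : R) : 0 < eps ->
  let k : R := m.+2%:R in
  exists G : digraph,
    [/\ dir_local_frac_chromatic G R <= k,
        extremal_ratio k - eps < frac_chromatic G R
      & dir_local_chromatic G = m.+2].
Proof.
move=> eps0 k; have kE : k = 1 + m.+1%:R / 1%:R by rewrite /k divr1 nat1r.
have k2 : 2 <= k by rewrite /k ler_nat.
have lt_half : extremal_ratio (k - 1 / 2) < extremal_ratio k.
  by apply: extremal_ratio_incr; lra.
(* The smaller error keeps the fractional chromatic number above the bound at k - 1/2. The point k -
   1 would not do: it equals 1 when k = 2, where part (a) does not apply. *)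
pose eps' := Num.min eps (extremal_ratio k - extremal_ratio (k - 1 / 2)).
have eps'0 : 0 < eps' by rewrite lt_min eps0 subr_gt0.
have [n nP] := tuple_graph_approx (leq0n m) eps'0; rewrite -kE in nP.
exists (tuple_graph n 0 m); split.
- by rewrite kE; exact: tuple_graph_local_frac_chromatic.
- by apply: le_lt_trans nP; rewrite lerD2l lerN2 ge_min lexx.
apply/eqP; rewrite eqn_leq tuple_graph_local_chromatic /= leqNgt; apply/negP.
rewrite ltnS => le; move: nP; apply/negP; rewrite -leNgt.
apply: (@le_trans _ _ (extremal_ratio (k - 1 / 2))).
  apply: frac_chromatic_le_local; first lra.
  apply: le_trans (dir_local_frac_chromatic_le_int R _) _.
  have : (dir_local_chromatic (tuple_graph n 0 m))%:R <= m.+1%:R :> R.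
    by rewrite ler_nat.
  by move/le_trans; apply; rewrite /k -[m.+2%:R]natr1; lra.
by rewrite lerBrDr -lerBrDl ge_min lexx orbT.
Qed.

Lemma exists_sharp (R : realType) (k eps : R) : 2 <= k -> 0 < eps ->
  exists G : digraph,
    dir_local_frac_chromatic G R <= k /\
    extremal_ratio k - eps < frac_chromatic G R.
Proof.
move=> k2 eps0; set f := extremal_ratio k.
have f0 : 0 < f by rewrite extremal_ratio_gt0; lra.
have b0 : 0 <= f / eps by rewrite divr_ge0 ?ltW.
(* The denominator [q.+1] exceeds f / eps. Rounding (k - 1) [q.+1] down gives a numerator with k -
   k' < 1 / [q.+1], so the loss f (k - k') stays below [eps]. *)
pose q := Num.bound (f / eps).
have q0 : 0 < q.+1%:R :> R by rewrite ltr0n.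
have qb : f / eps < q.+1%:R.
  by rewrite (lt_trans (archi_boundP b0)) // ltr_nat.
have kq0 : 0 <= (k - 1) * q.+1%:R by rewrite mulr_ge0 //; lra.
have /andP[lo hi] := truncn_itv kq0.
(* Since k >= 2, the numerator is at least the denominator, so windows fit and k' >= 2. *)
have q_le : (q.+1 <= Num.truncn ((k - 1) * q.+1%:R))%N.
  rewrite -ltnS -(ltr_nat R); apply: le_lt_trans hi.
  by rewrite ler_peMl //; lra.
case: (Num.truncn _) q_le lo hi => // m qm lo hi.
pose k' : R := 1 + m.+1%:R / q.+1%:R.
have k'2 : 2 <= k'.
  rewrite /k' -[2]/(1 + 1) lerD2l.
  by rewrite ler_pdivlMr // mul1r ler_nat.
have k'k : k' <= k by rewrite /k' -lerBrDl ler_pdivrMr.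
have near : k - k' < q.+1%:R^-1.
  rewrite /k' opprD addrA ltrBlDr.
  rewrite [ltRHS](_ : _ = m.+2%:R / q.+1%:R) ?ltr_pdivlMr //.
  by rewrite -[m.+2%:R]nat1r mulrDl mul1r.
have fk' : f - eps < extremal_ratio k'.
  apply: lt_le_trans (extremal_ratio_ge k'2 k'k).
  rewrite mulrBr mulr1 ltrD2l ltrN2.
  apply: lt_trans (_ : f * q.+1%:R^-1 < eps); first by rewrite ltr_pM2l.
  by rewrite ltr_pdivrMr // mulrC -ltr_pdivrMr.
have eps0' : 0 < extremal_ratio k' - (f - eps) by rewrite subr_gt0.
have [n nP] := tuple_graph_approx (qm : (q <= m)%N) eps0'.
exists (tuple_graph n q m); split.
  exact: le_trans (tuple_graph_local_frac_chromatic _ _ _ _) k'k.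
by move: nP; rewrite -/k' subKr.
Qed.

Theorem theorem4 (R : realType) :
  (forall G : digraph,
     let k := dir_local_frac_chromatic G R in
     1 < k ->
     frac_chromatic G R <= (k `^ k) / ((k - 1) `^ (k - 1)) /\
     (k `^ k) / ((k - 1) `^ (k - 1)) < expR 1 * k)
  /\
  (forall k eps : R, 2 <= k -> 0 < eps ->
     exists G : digraph,
       [/\ dir_local_frac_chromatic G R <= k,
           (k `^ k) / ((k - 1) `^ (k - 1)) - eps < frac_chromatic G R
         & k \is a Num.int -> (dir_local_chromatic G)%:R = k]).
Proof.
split=> [G k k1|k eps k2 eps0].
  by split; [exact: frac_chromatic_le_local|exact: extremal_ratio_lt_expR].
have [kint|knint] := boolP (k \is a Num.int); last first.
  have [G [Gk Gchi]] := exists_sharp k2 eps0.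
  by exists G; split=> // kint; rewrite kint in knint.
have /natrP[d kd] : k \is a Num.nat by rewrite natrEint kint; lra.
have d2 : (2 <= d)%N by rewrite -(ler_nat R) -kd.
case: d d2 kd => [|[|m]] // _ kd.
have [G [Gk Gchi Gd]] := exists_sharp_int m eps0.
by exists G; rewrite Gd kd; split.
Qed.
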